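(* Let $\gamma\in\mathbb{R}$, $x\in[\gamma,\gamma+1]$ and $\beta_1,\dots,\beta_n\in\mathbb{R}$ be such that $\lim_{m\to\infty}|B[m]|=\infty$, where $B=(\overline{\beta_1,\dots,\beta_n})$. Let $i\in\{1,\dots,n\}$ be such that $\prod_{j=1,\,j\ne i}^n\beta_j$ is fixed by the conjugate map $\beta_i\mapsto\lambda$, where $\lambda$ is a nontrivial conjugate of $\beta_i$ over $\mathbb{Q}(\beta_{i+1},\dots,\beta_n,\beta_1,\dots,\beta_{i-1})$. If $y:=T^{i-1}(x)\neq0$, then the following hold. 1. If $y\ne\gamma,\gamma+1$, then $$|z(\gamma;y)|=\begin{cases}\dfrac{\gamma+1}{2(\gamma-y)}+\dfrac12\sqrt{\dfrac{(\gamma+1)^2+4y(y-\gamma)}{(\gamma-y)^2}}, & \text{if }\gamma\ge-\tfrac12\text{ and }y\ge0,\\[2mm] \dfrac{y}{y-\gamma}, & \text{if }-1\le\gamma<-\tfrac12\text{ and }y\ge0,\\[2mm] \dfrac{y}{y-\gamma-1}, & \text{if }-\tfrac12\le\gamma<y<0,\\[2mm] \dfrac{\gamma}{2(\gamma+1-y)}+\dfrac12\sqrt{\dfrac{\gamma^2-4y(\gamma+1-y)}{(\gamma+1-y)^2}}, & \text{if }\gamma\le-\tfrac12\text{ and }y\le0.\end{cases}$$ 2. If $y=\gamma$, then $$|z(\gamma;y)|=\begin{cases}\dfrac{y}{y+1}, & \text{if }y>0,\\[2mm] -y, & \text{if }0>y\ge-\tfrac12,\\[2mm] \dfrac{y+\sqrt{y^2-4y}}{2},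 & \text{if }-\tfrac12\ge y.\end{cases}$$ 3. If $y=\gamma+1$, then $$|z(\gamma;y)|=\begin{cases}-\dfrac{y-\sqrt{y^2+4y}}{2}, & \text{if }y\ge\tfrac12,\\[2mm] y, & \text{if }0<y\le\tfrac12,\\[2mm] \dfrac{y}{y-1}, & \text{if }y<0.\end{cases}$$
   Context: Let $B=(\overline{\beta_1,\dots,\beta_n})$ denote the purely periodic sequence $(\beta_m)_{m\ge1}$ of real numbers with $\beta_{m+n}=\beta_m$, and $B[m]=\prod_{j=1}^m\beta_j$. For $x\in[\gamma,\gamma+1)$ put $T^0(x)=x$ and, for $m\ge1$, $a_m(x)=\lfloor \beta_m T^{m-1}(x)-\gamma\rfloor$ and $T^m(x)=\beta_mT^{m-1}(x)-a_m(x)\in[\gamma,\gamma+1)$. For $x=\gamma+1$ the same formulas are used, starting from $T^0(\gamma+1)=\gamma+1$ and $T^1(\gamma+1)=\beta_1(\gamma+1)-\lfloor\beta_1(\gamma+1)-\gamma\rfloor\in[\gamma,\gamma+1)$. With $K_i=\mathbb{Q}(\beta_1,\dots,\beta_{i-1},\beta_{i+1},\dots,\beta_n)$, a nontrivial conjugate of $\beta_i$ (algebraic over $K_i$) is a complex root $\lambda\ne\beta_i$ of its minimal polynomial over $K_i$, and the conjugate map is the field isomorphism $K_i(\beta_i)\to K_i(\lambda)$ over $K_i$ sending $\beta_i$ to $\lambda$. For real $\gamma$ and $y\in[\gamma,\gamma+1]$ with $y\ne0$, $z(\gamma;y)$ denotes a real solution $Z$ of minimal absolute value of the equation $$\frac{|Z|}{1-|Z|}=\left|\frac{2y-(2y-2\gamma-1)Z}{1-Z}\right|.$$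 *)

(* Defs.v *)
From mathcomp Require Import all_boot all_order all_algebra.
From mathcomp Require Import complex.
From mathcomp Require Import all_classical all_reals all_analysis.

Set Implicit Arguments.
Unset Strict Implicit.
Unset Printing Implicit Defensive.

Import Order.TTheory GRing.Theory Num.Theory.
Import numFieldNormedType.Exports.

Local Open Scope classical_set_scope.
Local Open Scope ring_scope.
Local Open Scope complex_scope.

Section BaseSequence.
Variable R : realType.

(* The purely periodic sequence, indexed from 1: [base_seq beta m] is beta_m,
   so that [base_seq beta j.+1] is the tuple entry of index [j] for [j < n]. *)
Definition base_seq n (beta : n.-tuple R) (m : nat) : R :=
  nth 0 beta (m.-1 %% n).

(* B[m] *)
Definition base_prod n (beta : n.-tuple R) (m : nat) : R :=
  \prod_(1 <= j < m.+1) base_seq beta j.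

(* T^m(x) *)
Fixpoint base_iter (gamma : R) n (beta : n.-tuple R) (m : nat) (x : R) : R :=
  if m is k.+1 then
    let t := base_seq beta k.+1 * base_iter gamma beta k x in
    t - (Num.floor (t - gamma))%:~R
  else x.

End BaseSequence.

Section Conjugates.

(* [divring_closed] is closure under 1, subtraction and division; in a field
   (where x / 0 = 0) this says that the set is a subfield. *)
Definition gen_subfield (F : fieldType) (S : set F) : set F :=
  smallest [set K : set F | divring_closed [pred u | u \in K]] S.

Definition adjoin (F : fieldType) (K : set F) (b : F) : set F :=
  gen_subfield (K `|` [set b]).

Variable R : realType.

(* K_i; the index [i : 'I_n] stands for i + 1. *)
Definition other_bases_field n (beta : n.-tuple R) (i : 'I_n) : set R :=
  gen_subfield [set tnth beta j | j in [set j : 'I_n | j != i]].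

Definition is_min_poly (K : set R) (b : R) (p : {poly R}) : Prop :=
  [/\ p \is monic,
      forall k, p`_k \in K,
      root p b
    & forall q : {poly R}, q != 0 -> (forall k, q`_k \in K) -> root q b ->
        (size p <= size q)%N].

Definition nontrivial_conjugate (K : set R) (b : R) (lambda : R[i]) : Prop :=
  exists p : {poly R},
    [/\ is_min_poly K b p,
        root (map_poly (real_complex R) p) lambda
      & lambda != b%:C].

(* Only the values of [sigma] on K(b) are constrained; K is seen inside the
   complex numbers through the embedding of the reals. *)
Definition conjugate_map (K : set R) (b : R) (lambda : R[i])
    (sigma : R -> R[i]) : Prop :=
  [/\ set_bij (adjoin K b) (adjoin (real_complex R @` K) lambda) sigma,
      {in adjoin K b &, {morph sigma : u v / u + v}},
      {in adjoin K b &, {morph sigma : u v / u * v}},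
      {in K, forall u, sigma u = u%:C}
    & sigma b = lambda].

End Conjugates.

Section MinimalSolution.
Variable R : realType.

(* Division being total, the denominators are required not to vanish: otherwise
   Z = 1 would always be a spurious solution. *)
Definition z_equation (gamma y Z : R) : Prop :=
  [/\ 1 - `|Z| != 0, 1 - Z != 0
    & `|Z| / (1 - `|Z|) =
      `|(2 * y - (2 * y - 2 * gamma - 1) * Z) / (1 - Z)|].

(* [Z] is an admissible value of z(gamma; y). *)
Definition is_z (gamma y Z : R) : Prop :=
  z_equation gamma y Z /\ forall W, z_equation gamma y W -> `|Z| <= `|W|.

End MinimalSolution.

(* Main.v *)
Require Import Defs.
From mathcomp Require Import all_boot all_order all_algebra.
From mathcomp Require Import complex.
From mathcomp Require Import all_classical all_reals all_analysis.
From mathcomp Require Import ring lra.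

(** Since the right-hand side of the equation is nonnegative, every solution
has |Z| < 1, so both denominators are positive and may be cleared.  Solving then
amounts to opening two absolute values, that of Z and that of the numerator.

The involution (gamma, y) |-> (- gamma - 1, - y) preserves the equation and
negates y, so one may assume y > 0; then gamma + 1 >= y > 0.  In that case the
numerator is never negative at a solution, which leaves two candidates:
- Z = t >= 0 with (y - gamma) t = y, where t < 1 forces gamma < 0;
- Z = - t <= 0 with f(t) = y, for f(t) = (y - gamma) t^2 + (gamma + 1) t.
As f is increasing on t >= 0 and f(1) = y + 1 > y, the second candidate exists,
is unique and is always a solution.  Since the first candidate t1 satisfies
f(t1) - y = y (2 gamma + 1) / (y - gamma), it is the smaller one exactly when
gamma <= - 1/2 ([is_z_neg_root], [is_z_pos_ratio]).

For y < 0 the involution gives the remaining formulas ([is_z_pos_root],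
[is_z_neg_ratio]).  All solutions of minimal modulus have the same modulus
([is_z_norm_uniq]), so in every branch of the theorem it is enough to recognize
the announced value as the modulus of one of these four minimal solutions; the
extreme values y = gamma and y = gamma + 1 are the instances in which a leading
coefficient becomes 0 or 1.  The bounds gamma <= y <= gamma + 1,
on which the sign discussion rests, hold along every orbit that starts in
[gamma, gamma + 1] ([base_iter_itv]). *)

Set Implicit Arguments.
Unset Strict Implicit.
Unset Printing Implicit Defensive.

Import Order.TTheory GRing.Theory Num.Theory.
Import numFieldNormedType.Exports.

Local Open Scope classical_set_scope.
Local Open Scope ring_scope.
Local Open Scope complex_scope.

Lemma base_iter_itv (R : realType) (gamma x : R) n (beta : n.-tuple R) m :
  gamma <= x <= gamma + 1 -> gamma <= base_iter gamma beta m x <= gamma + 1.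
Proof.
case: m => [//|m] _ /=; set t := _ * _.
have := floor_le (t - gamma).
have := floorD1_gt (t - gamma); rewrite intrD /=.
by move=> ? ?; apply/andP; split; lra.
Qed.

(** * The equation without denominators *)

Section Equation.
Variable R : realType.
Implicit Types gamma y Z t : R.

Lemma z_equationE gamma y Z :
  z_equation gamma y Z <->
  `|Z| < 1 /\
  `|Z| * (1 - Z) = `|2 * y - (2 * y - 2 * gamma - 1) * Z| * (1 - `|Z|).
Proof.
split=> [[nZ1 Z1]|[Zlt1]]; last first.
  have Z1 : 0 < 1 - Z by have := ler_norm Z; lra.
  have nZ1 : 0 < 1 - `|Z| by lra.
  move=> eqZ; split; try exact: lt0r_neq0.
  rewrite normrM normfV (gtr0_norm Z1); apply/eqP.
  by rewrite eqr_div ?lt0r_neq0 // eqZ.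
move=> eqZ.
have Zlt1 : `|Z| < 1.
  rewrite ltNge; apply/negP => Zge1.
  have Zgt1 : 1 - `|Z| < 0 by rewrite lt_neqAle nZ1 /=; lra.
  have : 0 <= `|Z| / (1 - `|Z|) by rewrite eqZ.
  by rewrite leNgt nmulr_llt0 ?invr_lt0 //; apply/negP; rewrite negbK; lra.
split=> //.
have Zpos : 0 < 1 - Z by have := ler_norm Z; lra.
move: eqZ; rewrite normrM normfV (gtr0_norm Zpos) => /eqP.
by rewrite eqr_div // => /eqP.
Qed.

(** The numerator only changes sign. *)
Lemma z_equation_sym gamma y Z :
  z_equation (- gamma - 1) (- y) Z <-> z_equation gamma y Z.
Proof.
rewrite !z_equationE.
suff -> : 2 * - y - (2 * - y - 2 * (- gamma - 1) - 1) * Z =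
          - (2 * y - (2 * y - 2 * gamma - 1) * Z) by rewrite normrN.
by ring.
Qed.

Lemma is_z_sym gamma y Z : is_z (- gamma - 1) (- y) Z <-> is_z gamma y Z.
Proof.
split=> -[eqZ minZ]; split; try exact/z_equation_sym;
  by move=> W eqW; apply: minZ; apply/z_equation_sym.
Qed.

Lemma is_z_norm_uniq gamma y Z W :
  is_z gamma y Z -> is_z gamma y W -> `|Z| = `|W|.
Proof.
move=> [eqZ minZ] [eqW minW]; apply/eqP.
by rewrite eq_le minZ ?minW.
Qed.

(** * Solutions for positive y *)

(** A negative numerator would require (gamma + 1 - y) t = - y, whose two sides
have different signs. *)
Lemma z_equation_ge0 gamma y t : 0 < y -> y <= gamma + 1 -> 0 <= t ->
  z_equation gamma y t <-> t < 1 /\ (y - gamma) * t = y.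
Proof.
move=> y0 y1 t0; rewrite z_equationE (ger0_norm t0).
split=> -[t1 eqt]; split=> //.
  have {eqt} : t = `|2 * y - (2 * y - 2 * gamma - 1) * t|.
    by apply: (mulIf (lt0r_neq0 (_ : 0 < 1 - t))); first lra.
  by case: ler0P => _ eqt; nra.
have -> : 2 * y - (2 * y - 2 * gamma - 1) * t = t by nra.
by rewrite (ger0_norm t0).
Qed.

(** A negative numerator would require (gamma + 1 - y) t^2 - gamma t + y = 0,
where the left-hand side is y (1 - t) + t^2 + (y - gamma) t (1 - t), hence
positive for 0 <= t < 1. *)
Lemma z_equation_le0 gamma y t :
  0 < y -> gamma <= y <= gamma + 1 -> 0 <= t ->
  z_equation gamma y (- t) <->
  t < 1 /\ (y - gamma) * t ^+ 2 + (gamma + 1) * t = y.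
Proof.
move=> y0 /andP[gy y1] t0; rewrite z_equationE normrN (ger0_norm t0).
split=> -[t1 eqt]; split=> //.
  move: eqt; case: ler0P => _ eqt; last by nra.
  suff : 0 < (gamma + 1 - y) * t ^+ 2 - gamma * t + y by nra.
  have : 0 <= (y - gamma) * (t * (1 - t)) by rewrite !mulr_ge0; lra.
  have : 0 < y * (1 - t) by rewrite mulr_gt0; lra.
  by nra.
have num_ge0 : 0 <= 2 * y - (2 * y - 2 * gamma - 1) * - t.
  rewrite -(pmulr_lge0 _ (_ : 0 < 1 - t)); last by lra.
  by nra.
by rewrite (ger0_norm num_ge0); nra.
Qed.

Lemma quadratic_le (a b s t : R) : 0 <= a -> 0 < b -> 0 <= s -> 0 <= t ->
  a * s ^+ 2 + b * s <= a * t ^+ 2 + b * t -> s <= t.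
Proof.
move=> a0 b0 s0 t0 le_st; rewrite leNgt; apply/negP => lt_ts.
have : 0 <= a * ((s - t) * (s + t)) by rewrite !mulr_ge0; lra.
have : 0 < b * (s - t) by rewrite mulr_gt0; lra.
by nra.
Qed.

Lemma is_z_neg_root gamma y t :
  0 < y -> gamma <= y <= gamma + 1 -> - (1 / 2) <= gamma ->
  0 <= t -> (y - gamma) * t ^+ 2 + (gamma + 1) * t = y ->
  is_z gamma y (- t).
Proof.
move=> y0 gy g2 t0 eqt.
have [g_le_y y_le_g1] := andP gy.
have t1 : t < 1.
  rewrite ltNge; apply/negP => t_ge1.
  have t2_ge1 : 1 <= t ^+ 2 by rewrite exprn_ege1.
  have : 0 <= (y - gamma) * (t ^+ 2 - 1) by rewrite mulr_ge0; lra.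
  have : 0 <= (gamma + 1) * (t - 1) by rewrite mulr_ge0; lra.
  by lra.
split; first exact/z_equation_le0.
move=> W; rewrite normrN (ger0_norm t0).
have [W0|W0] := leP 0 W.
  rewrite (ger0_norm W0) => /(z_equation_ge0 y0 y_le_g1 W0)[W1 eqW].
  apply: (@quadratic_le (y - gamma) (gamma + 1)); rewrite ?eqt //; try lra.
  (* here f(W) - y = (2 gamma + 1) W *)
  by rewrite expr2 mulrA eqW; nra.
rewrite (ltr0_norm W0) => eqW.
have W0' : 0 <= - W by lra.
move: eqW; rewrite -{1}(opprK W) => /(z_equation_le0 y0 gy W0')[W1 eqW].
by apply: (@quadratic_le (y - gamma) (gamma + 1)); rewrite ?eqt ?eqW //; lra.
Qed.

Lemma is_z_pos_ratio gamma y :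
  0 < y -> y <= gamma + 1 -> gamma <= - (1 / 2) ->
  is_z gamma y (y / (y - gamma)).
Proof.
move=> y0 y_le_g1 g2.
have gy : gamma <= y <= gamma + 1 by lra.
have yg : 0 < y - gamma by lra.
set t := y / (y - gamma).
have t0 : 0 <= t by rewrite divr_ge0 ?ltW.
have eqt : (y - gamma) * t = y by rewrite mulrC divfK ?lt0r_neq0.
split.
  apply/z_equation_ge0 => //; split=> //.
  by rewrite ltr_pdivrMr //; lra.
move=> W; rewrite (ger0_norm t0).
have [W0|W0] := leP 0 W.
  rewrite (ger0_norm W0) => /(z_equation_ge0 y0 y_le_g1 W0)[_ eqW].
  by rewrite -(ler_pM2l yg) eqt eqW.
rewrite (ltr0_norm W0) => eqW.
have W0' : 0 <= - W by lra.
move: eqW; rewrite -{1}(opprK W) => /(z_equation_le0 y0 gy W0')[_ eqW].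
apply: (@quadratic_le (y - gamma) (gamma + 1)); rewrite ?eqW //; try lra.
by rewrite expr2 mulrA eqt; nra.
Qed.

(** * Solutions for negative y *)

Lemma is_z_pos_root gamma y t :
  y < 0 -> gamma <= y <= gamma + 1 -> gamma <= - (1 / 2) ->
  0 <= t -> (gamma + 1 - y) * t ^+ 2 - gamma * t = - y ->
  is_z gamma y (- t).
Proof.
move=> y0 gy g2 t0 eqt; apply/is_z_sym.
by apply: is_z_neg_root => //; lra.
Qed.

Lemma is_z_neg_ratio gamma y :
  y < 0 -> gamma <= y -> - (1 / 2) <= gamma ->
  is_z gamma y (y / (y - gamma - 1)).
Proof.
move=> y0 gy g2; apply/is_z_sym.
have -> : y / (y - gamma - 1) = - y / (- y - (- gamma - 1)).
  rewrite -mulrNN -invrN.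
  by congr (_ / _); ring.
by apply: is_z_pos_ratio; lra.
Qed.

(** * The quadratic formula *)

(** With r the square root of the discriminant divided by a^2, the root is
(r - b / a) / 2, which is nonnegative because c >= 0 gives r >= |b / a|. *)
Lemma quadratic_root (a b c : R) : 0 < a -> 0 <= c ->
  let t := - b / (2 * a) + 1 / 2 * Num.sqrt ((b ^+ 2 + 4 * a * c) / a ^+ 2) in
  0 <= t /\ a * t ^+ 2 + b * t = c.
Proof.
move=> a0 c0 t; have a_neq0 := lt0r_neq0 a0.
have disc : (b ^+ 2 + 4 * a * c) / a ^+ 2 = (b / a) ^+ 2 + 4 * (c / a).
  by field.
have ca : 0 <= c / a by rewrite divr_ge0 // ltW.
have disc0 : 0 <= (b / a) ^+ 2 + 4 * (c / a).
  by have := sqr_ge0 (b / a); lra.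
move: @t; rewrite disc; set r := Num.sqrt _ => t.
have r2 : r ^+ 2 = (b / a) ^+ 2 + 4 * (c / a) by rewrite sqr_sqrtr.
have tE : t = (r - b / a) / 2 by rewrite /t; field.
split.
  rewrite tE divr_ge0 // subr_ge0 (le_trans (ler_norm _)) // -sqrtr_sqr.
  by rewrite ler_wsqrtr // lerDl mulr_ge0.
have bE : b = a * (b / a) by field.
have cE : c = a * (c / a) by field.
rewrite tE [in b * _]bE [RHS]cE.
have {}r2 : c / a = (r ^+ 2 - (b / a) ^+ 2) / 4 by rewrite r2; field.
by rewrite r2; field.
Qed.

End Equation.

Theorem theorem2p2 (R : realType) (gamma x : R) (n : nat) (beta : n.-tuple R)
    (x_in : gamma <= x <= gamma + 1)
    (B_infty : (fun m : nat => `|base_prod beta m|) @ \oo --> +oo)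
    (i : 'I_n) (lambda : R[i]) (sigma : R -> R[i])
    (conj_lambda : nontrivial_conjugate (other_bases_field beta i)
                     (tnth beta i) lambda)
    (conj_sigma : conjugate_map (other_bases_field beta i)
                    (tnth beta i) lambda sigma)
    (prod_fixed : sigma (\prod_(j < n | j != i) tnth beta j) =
                    (\prod_(j < n | j != i) tnth beta j)%:C)
    (y : R) (def_y : y = base_iter gamma beta i x) (y_neq0 : y != 0) :
  (exists z : R, is_z gamma y z) /\
  forall z : R, is_z gamma y z ->
  [/\ y != gamma -> y != gamma + 1 ->
      [/\ - (1 / 2) <= gamma -> 0 <= y ->
            `|z| = (gamma + 1) / (2 * (gamma - y)) +
                   1 / 2 * Num.sqrt (((gamma + 1) ^+ 2 + 4 * y * (y - gamma)) /
                                     (gamma - y) ^+ 2),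
          -1 <= gamma -> gamma < - (1 / 2) -> 0 <= y ->
            `|z| = y / (y - gamma),
          - (1 / 2) <= gamma -> gamma < y -> y < 0 ->
            `|z| = y / (y - gamma - 1)
        & gamma <= - (1 / 2) -> y <= 0 ->
            `|z| = gamma / (2 * (gamma + 1 - y)) +
                   1 / 2 * Num.sqrt ((gamma ^+ 2 - 4 * y * (gamma + 1 - y)) /
                                     (gamma + 1 - y) ^+ 2)],
      y = gamma ->
      [/\ 0 < y -> `|z| = y / (y + 1),
          0 > y -> y >= - (1 / 2) -> `|z| = - y
        & - (1 / 2) >= y -> `|z| = (y + Num.sqrt (y ^+ 2 - 4 * y)) / 2]
    & y = gamma + 1 ->
      [/\ 1 / 2 <= y -> `|z| = - ((y - Num.sqrt (y ^+ 2 + 4 * y)) / 2),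
          0 < y -> y <= 1 / 2 -> `|z| = y
        & y < 0 -> `|z| = y / (y - 1)]].
Proof.
have gy : gamma <= y <= gamma + 1 by rewrite def_y base_iter_itv.
have [g_le_y y_le_g1] := andP gy.
have neg_root : 0 < y -> gamma < y -> - (1 / 2) <= gamma ->
    exists2 w, is_z gamma y w & `|w| = (gamma + 1) / (2 * (gamma - y)) +
      1 / 2 * Num.sqrt (((gamma + 1) ^+ 2 + 4 * y * (y - gamma)) /
                        (gamma - y) ^+ 2).
  move=> y0 lt_gy g2.
  have yg : 0 < y - gamma by lra.
  have [t0 eqt] := quadratic_root (gamma + 1) yg (ltW y0).
  eexists; first exact: (is_z_neg_root y0 gy g2 t0 eqt).
  rewrite normrN (ger0_norm t0).
  have -> : 2 * (gamma - y) = - (2 * (y - gamma)) by ring.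
  have -> : (gamma - y) ^+ 2 = (y - gamma) ^+ 2 by ring.
  by rewrite invrN mulrN mulNr (mulrAC 4 y).
have pos_root : y < 0 -> y < gamma + 1 -> gamma <= - (1 / 2) ->
    exists2 w, is_z gamma y w & `|w| = gamma / (2 * (gamma + 1 - y)) +
      1 / 2 * Num.sqrt ((gamma ^+ 2 - 4 * y * (gamma + 1 - y)) /
                        (gamma + 1 - y) ^+ 2).
  move=> y0 lt_yg1 g2.
  have yg : 0 < gamma + 1 - y by lra.
  have Ny0 : 0 <= - y by lra.
  have [t0 eqt] := quadratic_root (- gamma) yg Ny0.
  eexists; first by apply: (is_z_pos_root y0 gy g2 t0); rewrite -mulNr.
  rewrite normrN (ger0_norm t0) opprK sqrrN.
  by rewrite mulrN (mulrAC 4 y).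
have neg_root_edge : 0 < y -> y = gamma ->
    exists2 w, is_z gamma y w & `|w| = y / (y + 1).
  move=> y0 eq_y; have y1 : 0 < y + 1 by lra.
  have t0 : 0 <= y / (y + 1) by rewrite divr_ge0 ?ltW.
  exists (- (y / (y + 1))); last by rewrite normrN ger0_norm.
  apply: is_z_neg_root => //; first lra.
  by rewrite -eq_y subrr mul0r add0r mulrC divfK ?lt0r_neq0.
have pos_root_edge : y < 0 -> y = gamma + 1 ->
    exists2 w, is_z gamma y w & `|w| = y / (y - 1).
  move=> y0 eq_y; have y1 : y - 1 < 0 by lra.
  have t0 : 0 <= y / (y - 1) by rewrite ltW // nmulr_rgt0 ?invr_lt0.
  exists (- (y / (y - 1))); last by rewrite normrN ger0_norm.
  apply: is_z_pos_root => //; first lra.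
  rewrite -eq_y subrr mul0r add0r (_ : gamma = y - 1); last by lra.
  by rewrite mulrC divfK ?ltr0_neq0.
have pos_ratio : 0 < y -> gamma <= - (1 / 2) ->
    exists2 w, is_z gamma y w & `|w| = y / (y - gamma).
  move=> y0 g2; exists (y / (y - gamma)); first exact: is_z_pos_ratio.
  by rewrite ger0_norm // divr_ge0; lra.
have neg_ratio : y < 0 -> - (1 / 2) <= gamma ->
    exists2 w, is_z gamma y w & `|w| = y / (y - gamma - 1).
  move=> y0 g2; exists (y / (y - gamma - 1)); first exact: is_z_neg_ratio.
  by rewrite gtr0_norm // nmulr_rgt0 ?invr_lt0; lra.
split.
  suff [r [w zw _]] : exists r, exists2 w, is_z gamma y w & `|w| = r by exists w.
  case: (ltgtP y 0) y_neq0 => // y0 _.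
    have [g2|g2] := leP (- (1 / 2)) gamma; first by eexists; exact: neg_ratio.
    have [lt_yg1|] := ltP y (gamma + 1); first by eexists; apply: pos_root; lra.
    by move=> ?; eexists; apply: pos_root_edge; lra.
  have [g2|g2] := leP gamma (- (1 / 2)); first by eexists; exact: pos_ratio.
  have [lt_gy|] := ltP gamma y; first by eexists; apply: neg_root; lra.
  by move=> ?; eexists; apply: neg_root_edge; lra.
move=> z zP.
have modulus r : (exists2 w, is_z gamma y w & `|w| = r) -> `|z| = r.
  by move=> [w wP <-]; exact: is_z_norm_uniq zP wP.
split.
- move=> y_neq_g y_neq_g1.
  have lt_gy : gamma < y by rewrite lt_neqAle eq_sym y_neq_g.
  have lt_yg1 : y < gamma + 1 by rewrite lt_neqAle y_neq_g1.
  split.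
  + move=> g2 y_ge0; apply/modulus/neg_root => //.
    by rewrite lt_neqAle eq_sym y_neq0.
  + move=> _ g2 y_ge0; apply/modulus/pos_ratio; last exact: ltW.
    by rewrite lt_neqAle eq_sym y_neq0.
  + by move=> g2 _ y0; apply/modulus/neg_ratio.
  + move=> g2 y_le0; apply/modulus/pos_root => //.
    by rewrite lt_neqAle y_neq0.
- move=> eq_y; split.
  + by move=> y0; apply/modulus/neg_root_edge.
  + move=> y0 y2; rewrite (modulus _ (neg_ratio _ _)) -?eq_y //.
    by rewrite subrr sub0r invrN1 mulrN1.
  + move=> y2; rewrite (modulus _ (pos_root _ _ _)) -?eq_y //; try lra.
    have -> : y + 1 - y = 1 by ring.
    by rewrite expr1n !mulr1 divr1; lra.
- move=> eq_y; have g_eq : gamma = y - 1 by lra.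
  split.
  + move=> y2; rewrite (modulus _ (neg_root _ _ _)) ?g_eq; try lra.
    have -> : y - 1 + 1 = y by ring.
    have -> : y - 1 - y = - 1 by ring.
    have -> : y - (y - 1) = 1 by ring.
    by rewrite sqrrN expr1n !mulr1 mulrN1 invrN divr1; lra.
  + move=> y0 y2; rewrite (modulus _ (pos_ratio _ _)) ?g_eq //; try lra.
    have -> : y - (y - 1) = 1 by ring.
    by rewrite divr1.
  + by move=> y0; apply/modulus/pos_root_edge.
Qed.
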